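(* Assume that the bounded bilinear form $b:Y\times V\to\mathbb{R}$ satisfies the following: there is a constant $C_b>0$ with $$C_b\|y\|_Y\le \sup_{0\ne v\in V}\frac{b(y,v)}{\|v\|_V}\quad\forall y\in Y,\qquad\text{and}\qquad \{v\in V: b(y,v)=0\ \text{for all } y\in Y\}=\{0\}.$$ Let $(\bar{\mathsf y},\bar{\mathsf u})\in Y\times U_{ad}$ be the unique solution of $$\min\{J(\mathsf y,\mathsf u):(\mathsf y,\mathsf u)\in Y\times U_{ad}\}\quad\text{subject to}\quad b(\mathsf y,v)=\langle D\mathsf u,v\rangle_{V',V}\ \ \forall v\in V.$$ Then the optimal control $\bar{\mathsf u}$ satisfies $$(\mathcal I_{U'}^{U}D^*\bar{\mathsf p}+\alpha\bar{\mathsf u},\ \mathsf u-\bar{\mathsf u})_U\ge 0\qquad\forall \mathsf u\in U_{ad},$$ where $\bar{\mathsf p}\in V$ is the unique solution of the adjoint equation $B^*\bar{\mathsf p}=O^*\mathcal I_{\mathcal Y}^{\mathcal Y'}(O\bar{\mathsf y}-\mathsf y_d)$ in $Y'$.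
   Context: $U,Y,V,\mathcal Y$ are real Hilbert spaces; $U_{ad}\subseteq U$ is non-empty, bounded, closed and convex; $b:Y\times V\to\mathbb{R}$ is a bounded bilinear form and $B:Y\to V'$ is given by $\langle By,v\rangle_{V',V}=b(y,v)$; $O:Y\to\mathcal Y$ and $D:U\to V'$ are bounded linear operators; $\mathsf y_d\in\mathcal Y$ and $\alpha>0$ are given. The cost functional is $$J(\mathsf y,\mathsf u):=\tfrac12\|O\mathsf y-\mathsf y_d\|_{\mathcal Y}^2+\tfrac{\alpha}{2}\|\mathsf u\|_U^2 .$$ For a bounded linear operator $T:X\to Z$, $T^*:Z'\to X'$ is its dual; biduals are identified with the original Hilbert spaces, so $B^*:V\to Y'$ and $D^*:V\to U'$. $\mathcal I_{X}^{X'}:X\to X'$ is the canonical (Riesz) isomorphism of a Hilbert space $X$ onto its dual, and $\mathcal I_{X'}^{X}$ is its inverse. *)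

(* Defs.v *)
From HB Require Import structures.
From mathcomp Require Import all_boot all_order all_algebra.
From mathcomp Require Import all_classical all_reals all_analysis.
From mathcomp Require Import lra.

Set Implicit Arguments.
Unset Strict Implicit.
Unset Printing Implicit Defensive.

Import Order.TTheory GRing.Theory Num.Theory.
Import numFieldNormedType.Exports.

Local Open Scope classical_set_scope.
Local Open Scope ring_scope.

(* [{dot H for idfun}] is the type of symmetric positive definite bilinear
   forms. *)
HB.mixin Record CompleteNormedModule_isHilbert (R : realType) H
    & CompleteNormedModule R H := {
  hdot : {dot H for (@idfun R)} ;
  hdot_norm : forall x : H, (hdot : H -> H -> R) x x = `|x| ^+ 2
}.

#[short(type="hilbertType")]
HB.structure Definition Hilbert (R : realType) :=
  {H of CompleteNormedModule R H & CompleteNormedModule_isHilbert R H}.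

Definition inner (R : realType) (H : hilbertType R) (x y : H) : R := hdot x y.

Section bounded_linear_operators.
Context {R : realType} (X Z : normedModType R).

Definition bounded_linear : set (X -> Z) :=
  [set f | linear f /\ exists M : R, forall x, `|f x| <= M * `|x|].

Definition bop_pred : {pred X -> Z} := mem bounded_linear.

Record bop := Bop { bop_fun :> X -> Z ; _ : bop_fun \in bop_pred }.

HB.instance Definition _ := [isSub for bop_fun].
HB.instance Definition _ := [Choice of bop by <:].

Lemma bop_submod_closed : submod_closed bop_pred.
Proof.
split=> [|a f g].
  rewrite inE; split=> [k x y|]; first by rewrite /= scaler0 addr0.
  by exists 0 => x /=; rewrite normr0 mul0r.
rewrite !inE => -[lf [M fM]] [lg [N gN]]; split=> [k x y|].
  change (a *: f (k *: x + y) + g (k *: x + y) =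
    k *: (a *: f x + g x) + (a *: f y + g y)).
  by rewrite lf lg !scalerDr !scalerA [a * k]mulrC addrACA.
exists (`|a| * M + N) => x.
change (`|a *: f x + g x| <= (`|a| * M + N) * `|x|).
rewrite (le_trans (ler_normD _ _))// mulrDl lerD//.
by rewrite normrZ -mulrA ler_wpM2l.
Qed.

HB.instance Definition _ := GRing.isSubmodClosed.Build _ _ bop_pred
  bop_submod_closed.
HB.instance Definition _ := [SubChoice_isSubLmodule of bop by <:].

Lemma bopP (f g : bop) : f =1 g -> f = g.
Proof. by move=> fg; exact/val_inj/funext. Qed.

Lemma bop_linear (f : bop) : linear f.
Proof. by case: f => f /=; rewrite inE => -[]. Qed.

Lemma bop_bounded (f : bop) : exists M : R, forall x, `|f x| <= M * `|x|.
Proof. by case: f => f /=; rewrite inE => -[]. Qed.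

HB.instance Definition _ (f : bop) :=
  GRing.isLinear.Build R X Z *:%R (bop_fun f) (@bop_linear f).

Definition opnorm (f : bop) : R := sup [set `|f x| | x in [set x | `|x| <= 1]].

Lemma opnorm_has_sup (f : bop) :
  has_sup [set `|f x| | x in [set x | `|x| <= 1]].
Proof.
split; first by exists `|f 0|, 0 => //=; rewrite normr0.
have [M fM] := bop_bounded f; exists `|M| => _ [x /= x1 <-].
rewrite (le_trans (fM x))// (le_trans (ler_norm _))// normrM normr_id.
by rewrite -[leRHS]mulr1 ler_wpM2l.
Qed.

Lemma opnorm_ub (f : bop) x : `|x| <= 1 -> `|f x| <= opnorm f.
Proof. by move=> x1; apply: (sup_upper_bound (opnorm_has_sup f)); exists x. Qed.

Lemma opnorm_le (f : bop) (M : R) :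
  (forall x, `|x| <= 1 -> `|f x| <= M) -> opnorm f <= M.
Proof.
move=> fM; apply: ge_sup; first by case: (opnorm_has_sup f).
by move=> _ [x /= x1 <-]; exact: fM.
Qed.

Lemma opnorm_ge0 (f : bop) : 0 <= opnorm f.
Proof. by rewrite (le_trans _ (@opnorm_ub f 0 _))// normr0. Qed.

Lemma le_opnorm (f : bop) x : `|f x| <= opnorm f * `|x|.
Proof.
have [->|x0] := eqVneq x 0; first by rewrite linear0 !normr0 mulr0.
have nx0 : 0 < `|x| by rewrite normr_gt0.
rewrite -ler_pdivrMr// mulrC -[X in X * _]gtr0_norm ?invr_gt0// -normrZ.
rewrite -linearZ opnorm_ub// normrZ gtr0_norm ?invr_gt0// mulVf//.
exact: lt0r_neq0.
Qed.

Lemma opnormD (f g : bop) : opnorm (f + g) <= opnorm f + opnorm g.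
Proof.
apply: opnorm_le => x x1; change (`|f x + g x| <= opnorm f + opnorm g).
by rewrite (le_trans (ler_normD _ _))// lerD// opnorm_ub.
Qed.

Lemma opnormZ (a : R) (f : bop) : opnorm (a *: f) = `|a| * opnorm f.
Proof.
have leZ (b : R) (g : bop) : opnorm (b *: g) <= `|b| * opnorm g.
  apply: opnorm_le => x x1; change (`|b *: g x| <= `|b| * opnorm g).
  by rewrite normrZ ler_wpM2l// opnorm_ub.
apply/le_anti; rewrite leZ/=.
have [->|a0] := eqVneq a 0; first by rewrite normr0 mul0r opnorm_ge0.
rewrite -ler_pdivlMl ?normr_gt0// -normfV.
by rewrite -{1}[f](scalerK a0) leZ.
Qed.

Lemma opnorm_eq0 (f : bop) : opnorm f = 0 -> f = 0.
Proof.
move=> f0; apply: bopP => x; change (f x = 0); apply/normr0_eq0/le_anti.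
by rewrite normr_ge0 andbT -(mul0r `|x|) -f0 le_opnorm.
Qed.

HB.instance Definition _ := Lmodule_isNormed.Build R bop
  opnormD opnormZ opnorm_eq0.

Lemma mk_bop_subproof (f : X -> Z) :
  linear f -> (exists M : R, forall x, `|f x| <= M * `|x|) -> f \in bop_pred.
Proof. by move=> lf bf; rewrite inE. Qed.

Definition mk_bop (f : X -> Z) (lf : linear f)
  (bf : exists M : R, forall x, `|f x| <= M * `|x|) : bop :=
  Bop (mk_bop_subproof lf bf).

End bounded_linear_operators.

Definition dual (R : realType) (X : normedModType R) : normedModType R :=
  bop X R^o.

Section canonical_maps.
Context {R : realType}.

Section adjoint.
Context {X Z : normedModType R} (T : bop X Z).

Lemma bop_comp_linear (f : dual Z) : linear (f \o T : X -> R^o).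
Proof. by move=> a x y; rewrite /= !linearP. Qed.

Lemma bop_comp_bounded (f : dual Z) :
  exists M : R, forall x, `|(f \o T : X -> R^o) x| <= M * `|x|.
Proof.
exists (opnorm f * opnorm T) => x; rewrite (le_trans (le_opnorm f _))//.
by rewrite -mulrA ler_wpM2l ?opnorm_ge0// le_opnorm.
Qed.

Definition comp_bop (f : dual Z) : dual X :=
  mk_bop (bop_comp_linear f) (bop_comp_bounded f).

Lemma comp_bop_linear : linear comp_bop.
Proof. by move=> a f g; exact: bopP. Qed.

Lemma comp_bop_bounded : exists M : R, forall f, `|comp_bop f| <= M * `|f|.
Proof.
exists (opnorm T) => f; apply: opnorm_le => x x1.
rewrite (le_trans (le_opnorm f _))// mulrC ler_wpM2r//; first exact: opnorm_ge0.
exact: opnorm_ub.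
Qed.

Definition adj : bop (dual Z) (dual X) :=
  mk_bop comp_bop_linear comp_bop_bounded.

End adjoint.

Section bidual.
Context {X : normedModType R}.

Lemma eval_linear (x : X) : linear ((fun f => f x) : dual X -> R^o).
Proof. by []. Qed.

Lemma eval_bounded (x : X) :
  exists M : R, forall f : dual X, `|f x| <= M * `|f|.
Proof. by exists `|x| => f; rewrite mulrC; exact: le_opnorm. Qed.

Definition bidual (x : X) : dual (dual X) :=
  mk_bop (@eval_linear x) (@eval_bounded x).

End bidual.

(* The dual of an operator into [dual Z], as an operator on [Z] itself rather
   than on the bidual. *)
Definition adj_dual (X Z : normedModType R) (T : bop X (dual Z)) (z : Z) :
  dual X := adj T (bidual z).

Section riesz.
Context {H : hilbertType R}.

Lemma innerxx (x : H) : inner x x = `|x| ^+ 2.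
Proof. exact: hdot_norm. Qed.

Lemma innerC (x y : H) : inner x y = inner y x.
Proof. by rewrite /inner hermC expr0 mul1r. Qed.

Lemma inner_linear (x : H) : linear (inner x : H -> R^o).
Proof. by move=> a y z; rewrite /inner linearPr. Qed.

Lemma innerDr (x y z : H) : inner x (y + z) = inner x y + inner x z.
Proof. by have := inner_linear x 1 y z; rewrite !scale1r. Qed.

Lemma innerZr (a : R) (x y : H) : inner x (a *: y) = a * inner x y.
Proof.
have inner0 : inner x 0 = 0.
  by apply: (@addrI _ (inner x 0)); rewrite -innerDr !addr0.
by have := inner_linear x a y 0; rewrite inner0 !addr0.
Qed.

Lemma CauchySchwarz_inner (x y : H) : `|inner x y| <= `|x| * `|y|.
Proof.
suff leCS (z : H) : inner x z <= `|x| * `|z|.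
  rewrite ler_norml leCS andbT lerNl -mulN1r -innerZr scaleN1r -[`|y|]normrN.
  exact: leCS.
have : `|x + z| ^+ 2 <= (`|x| + `|z|) ^+ 2 by rewrite lerXn2r ?nnegrE// ler_normD.
rewrite -innerxx innerDr innerC innerDr (innerC (x + z)) innerDr !innerxx.
rewrite (innerC z x) sqrrD.
by lra.
Qed.

Lemma inner_bounded (x : H) : exists M : R, forall y, `|inner x y| <= M * `|y|.
Proof. by exists `|x| => y; exact: CauchySchwarz_inner. Qed.

Definition riesz (x : H) : dual H :=
  mk_bop (@inner_linear x) (@inner_bounded x).

(* [riesz] is bijective by the Riesz representation theorem, so the default
   value of the partial inverse is never used. *)
Definition riesz_inv : dual H -> H := 'pinv_(fun=> 0) [set: H] riesz.

End riesz.

Section bilinear_form.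
Context {Y V : normedModType R} (b : {bilinear Y -> V -> R^o}).

Definition bounded_bilinear : Prop :=
  exists M : R, forall y v, `|b y v| <= M * `|y| * `|v|.

Hypothesis bb : bounded_bilinear.

Lemma form_linearr (y : Y) : linear (b y).
Proof. by move=> a u v; rewrite linearPr. Qed.

Lemma form_boundedr (y : Y) : exists M : R, forall v, `|b y v| <= M * `|v|.
Proof. by have [M bM] := bb; exists (M * `|y|). Qed.

Definition form_dual (y : Y) : dual V :=
  mk_bop (@form_linearr y) (form_boundedr y).

Lemma form_dual_linear : linear form_dual.
Proof.
by move=> a y z; apply: bopP => v; rewrite /form_dual/= linearPl.
Qed.

Lemma form_dual_bounded : exists M : R, forall y, `|form_dual y| <= M * `|y|.
Proof.
have [M bM] := bb; exists `|M| => y; apply: opnorm_le => v v1.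
rewrite (le_trans (bM y v))// (le_trans (ler_norm _))// !normrM !normr_id.
by rewrite ler_piMr// mulr_ge0.
Qed.

Definition form_op : bop Y (dual V) :=
  mk_bop form_dual_linear form_dual_bounded.

End bilinear_form.

End canonical_maps.

Section optimal_control.
Context {R : realType} {U Y V W : hilbertType R}.
Variables (Uad : set U) (b : {bilinear Y -> V -> R^o}) (D : bop U (dual V)).
Variables (O : bop Y W) (yd : W) (alpha : R).

Definition cost (y : Y) (u : U) : R :=
  2^-1 * `|O y - yd| ^+ 2 + alpha / 2 * `|u| ^+ 2.

Definition admissible : set (Y * U) :=
  [set yu | Uad yu.2 /\ forall v : V, b yu.1 v = D yu.2 v].

Definition optimal : set (Y * U) :=
  [set yu | admissible yu /\
    forall yu', admissible yu' -> cost yu.1 yu.2 <= cost yu'.1 yu'.2].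

End optimal_control.

(* Main.v *)
(** If A : X -> Z is bounded below, then 1/2 |A x|^2 - f x is continuous and
    strongly convex, so it has a minimizer, which solves <A x, A z> = f z for all
    z.  With A the identity this is the Riesz representation theorem.  With A the
    operator B followed by the Riesz map of V, bounded below by the inf-sup
    condition, it gives the surjectivity of B* (take p = A x) and, using the
    nondegeneracy, that of B.  The state is then S u with S = B^-1 D bounded, so
    the reduced cost is a strongly convex quadratic function of the control.  Its
    slope at the minimizer in an admissible direction h is
    <O y - yd, O S h> + alpha <u, h>, and the adjoint equation turns the first
    term into b (S h) p = (D h) p = <D* p, h>. *)

Require Import Defs.
From HB Require Import structures.
From mathcomp Require Import all_boot all_order all_algebra.
From mathcomp Require Import all_classical all_reals all_analysis.
From mathcomp Require Import ring lra.

Set Implicit Arguments.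
Unset Strict Implicit.
Unset Printing Implicit Defensive.

Import Order.TTheory GRing.Theory Num.Theory.
Import numFieldNormedType.Exports.

Local Open Scope classical_set_scope.
Local Open Scope ring_scope.

(** * First-order conditions and existence of minimizers *)

Lemma quadratic_slope_ge0 (R : realFieldType) (g q : R) :
  (forall t, 0 < t -> t <= 1 -> 0 <= t * g + t ^+ 2 * q) -> 0 <= g.
Proof.
move=> slope; rewrite leNgt; apply/negP => g0.
have d0 : 0 < `|q| + 1 - g by have := normr_ge0 q; lra.
(* For this [t] one has [t * |q| = - g - t * (1 - g)], hence [g + t * q <= - t * (1 - g) < 0],
   against [slope]. *)
have t0 : 0 < - g / (`|q| + 1 - g) by rewrite divr_gt0// oppr_gt0.
have t1 : - g / (`|q| + 1 - g) <= 1.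
  by rewrite ler_pdivrMr// mul1r; have := normr_ge0 q; lra.
have := slope _ t0 t1; set t := _ / _ in t0 t1 *.
rewrite expr2 -mulrA -mulrDr pmulr_rge0//.
have tE : t * (`|q| + 1 - g) = - g by rewrite mulfVK// gt_eqF.
have : t * q <= t * `|q| by rewrite ler_wpM2l ?ler_norm// ltW.
by nra.
Qed.

(* The sublevel sets [F x < inf F + e] have small diameter by midpoint
   convexity, hence form a Cauchy filter base. *)
Lemma strongly_convex_min (R : realType) (X : completeNormedModType R)
    (K : set X) (F : X -> R) (c m : R) :
  0 < c -> closed K -> K !=set0 -> continuous F ->
  (forall x, K x -> m <= F x) ->
  (forall x y, K x -> K y -> K (2^-1 *: (x + y)) /\
    F (2^-1 *: (x + y)) + c * `|x - y| ^+ 2 <= (F x + F y) / 2) ->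
  exists2 x, K x & forall y, K y -> F x <= F y.
Proof.
move=> c0 clK [x0 Kx0] cF mF midF; set i := inf (F @` K).
have iF x : K x -> i <= F x.
  by move=> Kx; apply: ge_inf; [exists m => _ [y Ky <-]; exact: mF|exists x].
pose B (e : R) := [set x | K x /\ F x < i + e].
have B0 e : 0 < e -> B e !=set0.
  move=> e0; have [||_ [x Kx <-] xe] := @inf_adherent R (F @` K) e => //.
    by split; [exists (F x0), x0|exists m => _ [y Ky <-]; exact: mF].
  by exists x.
pose Phi := filter_from [set e : R | 0 < e] B.
have PhiF : ProperFilter Phi.
  apply: filter_from_proper => //; apply: filter_from_filter.
    by exists 1; rewrite /= ltr01.
  move=> e e' /= e0 e'0; exists (Num.min e e'); first by rewrite lt_min e0.
  by move=> x [Kx]; rewrite -ltrBlDl lt_min => /andP[xe xe']; split; split=> //;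
    rewrite -ltrBlDl.
have /cauchy_cvg/cvg_ex[l Phil] : cauchy Phi.
  (* The level [c * e ^+ 2] is the one that yields distances below [e]: [F] is at least [i] at the
     midpoint of two points of that sublevel set, so [c * |x - y| ^+ 2 < c * e ^+ 2]. *)
  apply: cauchy_exP => e e0; have d0 : 0 < c * e ^+ 2.
    by rewrite mulr_gt0// exprn_gt0.
  have [x [Kx xd]] := B0 _ d0; exists x, (c * e ^+ 2) => //= y [Ky yd].
  rewrite -ball_normE/= -(@ltr_pXn2r _ 2)// ?nnegrE// ?(ltW e0)//.
  have [Kxy] := midF _ _ Kx Ky; have := iF _ Kxy.
  by rewrite -(ltr_pM2l c0); lra.
have FK : \forall x \near Phi, K x.
  by exists 1; rewrite /= ?ltr01// => x [].
exists l; first exact: (closed_cvg K clK FK l Phil).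
move=> y Ky; apply: (le_trans _ (iF y Ky)); apply/ler_addgt0Pr => e e0.
have Fe : \forall x \near Phi, F x <= i + e.
  by exists e => // x [_ /ltW].
apply: (closed_cvg (fun r => r <= i + e) (@closed_le R _) Fe).
exact: cvg_comp Phil (cF l).
Qed.

(** * Bounded operators and functionals *)

Section bop_morphism.
Context {R : realType} {X Z : normedModType R} (T : bop X Z).

Lemma bopD x y : T (x + y) = T x + T y.
Proof. exact: linearD. Qed.

Lemma bopZ (a : R) x : T (a *: x) = a *: T x.
Proof. exact: linearZ. Qed.

Lemma bopB x y : T (x - y) = T x - T y.
Proof. exact: linearB. Qed.

End bop_morphism.

Lemma bop_continuous (R : realType) (X Z : normedModType R) (T : bop X Z) :
  continuous T.
Proof.
apply/linear_bounded_continuous/bounded_funP => r; exists (opnorm T * r) => x xr.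
by rewrite (le_trans (le_opnorm T x))// ler_wpM2l ?opnorm_ge0.
Qed.

Lemma sqr_norm_continuous (R : realType) (X : normedModType R) :
  continuous (fun x : X => `|x| ^+ 2).
Proof.
move=> x; apply: (@continuous_comp _ _ _ (fun x : X => `|x|) (fun r => r ^+ 2)).
  exact: norm_continuous.
exact: exprn_continuous.
Qed.

Section functional.
Context {R : realType} {X : normedModType R} (f : dual X).

(* Restated from [linearD] and [linearZ] with the operations of [R] rather than
   those of [R^o]. *)
Lemma dualD x y : f (x + y) = f x + f y :> R.
Proof. exact: linearD. Qed.

Lemma dualZ (a : R) x : f (a *: x) = a * f x :> R.
Proof. exact: linearZ. Qed.

End functional.

(** * Quadratic minimization in Hilbert spaces and Riesz representation *)

Section hilbert.
Context {R : realType}.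

Section inner_product.
Context {H : hilbertType R}.
Implicit Types x y z : H.

Lemma innerDl x y z : inner (x + y) z = inner x z + inner y z.
Proof. by rewrite !(innerC _ z) innerDr. Qed.

Lemma innerZl (a : R) x y : inner (a *: x) y = a * inner x y.
Proof. by rewrite !(innerC _ y) innerZr. Qed.

Lemma normD_sqr x y : `|x + y| ^+ 2 = `|x| ^+ 2 + 2 * inner x y + `|y| ^+ 2.
Proof. by rewrite -!innerxx innerDl !innerDr (innerC y x); lra. Qed.

(** The parallelogram law, in the shape of the midpoint hypothesis of [strongly_convex_min]. *)
Lemma norm_midpoint x y :
  `|2^-1 *: (x + y)| ^+ 2 + 4^-1 * `|x - y| ^+ 2 =
  (`|x| ^+ 2 + `|y| ^+ 2) / 2.
Proof.
rewrite normrZ exprMn !normD_sqr normrN -scaleN1r innerZr gtr0_norm ?invr_gt0//.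
by field.
Qed.

Lemma opnorm_riesz_le x : opnorm (riesz x) <= `|x|.
Proof.
apply: opnorm_le => y y1.
by rewrite (le_trans (CauchySchwarz_inner x y))// ler_piMr.
Qed.

End inner_product.

Lemma bounded_below_solve (X Z : hilbertType R) (T : bop X Z) (C : R)
    (f : dual X) :
  0 < C -> (forall x, C * `|x| <= `|T x|) ->
  exists x, forall z, inner (T x) (T z) = f z.
Proof.
move=> C0 TC.
pose F x : R := 2^-1 * `|T x| ^+ 2 - f x.
have cF : continuous F.
  move=> x; apply: (@cvgB _ R^o _ _ _ (fun x => 2^-1 * `|T x| ^+ 2) f).
    apply: cvgMr; apply: (@continuous_comp _ _ _ T (fun z => `|z| ^+ 2)).
      exact: bop_continuous.
    exact: sqr_norm_continuous.
  exact: bop_continuous.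
have TC2 x : C ^+ 2 * `|x| ^+ 2 <= `|T x| ^+ 2.
  by rewrite -exprMn lerXn2r ?nnegrE// mulr_ge0// ltW.
(* Half of the 1/4 in [norm_midpoint], combined with [TC2], gives the modulus [C ^+ 2 / 8]. The
   lower bound comes from completing the square in [C ^+ 2 * |x| ^+ 2 / 2 - opnorm f * |x|]. *)
have [|||x y _ _|x _ minx] := @strongly_convex_min R X setT F (C ^+ 2 / 8)
  (- (opnorm f / C) ^+ 2 / 2) _ (@closedT _) _ cF.
- by rewrite divr_gt0// exprn_gt0.
- by exists 0.
- move=> x _; rewrite /F.
  have fx : f x <= opnorm f * `|x|.
    exact: le_trans (ler_norm _) (le_opnorm f x).
  have := TC2 x; have := sqr_ge0 (C * `|x| - opnorm f / C).
  have -> : (C * `|x| - opnorm f / C) ^+ 2 =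
      C ^+ 2 * `|x| ^+ 2 - 2 * (opnorm f * `|x|) + (opnorm f / C) ^+ 2.
    by field; rewrite gt_eqF.
  by lra.
- split=> //; rewrite /F dualZ dualD bopZ bopD.
  have := norm_midpoint (T x) (T y); have := TC2 (x - y); rewrite bopB.
  by lra.
have slope z : 0 <= inner (T x) (T z) - f z.
  apply: (@quadratic_slope_ge0 _ _ (2^-1 * `|T z| ^+ 2)) => t t0 _.
  have := minx (x + t *: z) I; rewrite /F dualD dualZ bopD bopZ normD_sqr innerZr.
  by rewrite normrZ exprMn (gtr0_norm t0); lra.
(* The slope is linear in [z] and nonnegative at both [z] and [- z], so it vanishes. *)
exists x => z; have := slope z; have := slope (- z).
by rewrite -scaleN1r dualZ bopZ innerZr; lra.
Qed.

Lemma id_bop_subproof (X : normedModType R) :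
  exists M : R, forall x : X, `|x| <= M * `|x|.
Proof. by exists 1 => x; rewrite mul1r. Qed.

Definition id_bop (X : normedModType R) : bop X X :=
  @mk_bop R X X idfun (fun a x y => erefl) (id_bop_subproof X).

Lemma riesz_invK (H : hilbertType R) : cancel (@riesz_inv R H) riesz.
Proof.
move=> f; apply: surjpK; last by rewrite inE.
move=> g _; have [|x xg] := @bounded_below_solve H H (id_bop H) 1 g ltr01.
  by move=> x; rewrite mul1r.
by exists x => //; apply: bopP.
Qed.

Lemma inner_riesz_inv (H : hilbertType R) (f : dual H) (x : H) :
  inner (riesz_inv f) x = f x.
Proof. by rewrite -{2}(riesz_invK f). Qed.

Lemma inner_inj (H : hilbertType R) (x y : H) :
  (forall z, inner x z = inner y z) -> x = y.
Proof.
move=> xy; apply/subr0_eq/normr0_eq0/eqP; rewrite -sqrf_eq0 -innerxx.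
by rewrite -scaleN1r innerDl innerZl xy; apply/eqP; lra.
Qed.

(** * Solvability under the inf-sup condition *)

Section inf_sup.
Context {Y V : hilbertType R} (b : {bilinear Y -> V -> R^o}).
Hypothesis bb : bounded_bilinear b.

Lemma form_riesz_linear : linear (riesz_inv \o form_op bb).
Proof.
move=> a x y; apply: inner_inj => z.
by rewrite innerDl innerZl !inner_riesz_inv/= linearPl.
Qed.

Lemma form_riesz_bounded :
  exists M : R, forall y, `|(riesz_inv \o form_op bb) y| <= M * `|y|.
Proof.
exists (opnorm (form_op bb)) => y /=; apply: le_trans (le_opnorm _ _).
(* Testing the functional on its own representer [r] gives
   [|r| ^+ 2 <= opnorm (form_op bb y) * |r|], and a nonzero [|r|] cancels. *)
have := le_opnorm (form_op bb y) (riesz_inv (form_op bb y)).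
rewrite -inner_riesz_inv innerxx ger0_norm ?sqr_ge0//.
have [->|n0] := eqVneq (riesz_inv (form_op bb y)) 0.
  by rewrite normr0 => _; exact: opnorm_ge0.
by rewrite expr2 ler_pM2r// normr_gt0.
Qed.

(** The values are moved from [dual V], which carries only a norm, into [V], because
    [bounded_below_solve] asks for a Hilbert space as target. *)
Definition form_riesz : bop Y V := mk_bop form_riesz_linear form_riesz_bounded.

Lemma inner_form_riesz y v : inner (form_riesz y) v = b y v.
Proof. exact: inner_riesz_inv. Qed.

Variable C : R.
Hypothesis C0 : 0 < C.
Hypothesis infsup : forall y : Y,
  C * `|y| <= sup [set b y v / `|v| | v in [set v : V | v != 0]].

Lemma form_op_bounded_below y : C * `|y| <= opnorm (form_op bb y).
Proof.
apply: le_trans (infsup y) _.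
(* If [V] is trivial the supremum ranges over the empty set and takes the default value 0. *)
have [->|/set0P ne] :=
    eqVneq [set b y v / `|v| | v in [set v : V | v != 0]] set0.
  by rewrite sup0 opnorm_ge0.
apply: ge_sup => // _ [v /= v0 <-]; rewrite ler_pdivrMr ?normr_gt0//.
exact: le_trans (ler_norm _) (le_opnorm (form_op bb y) v).
Qed.

Lemma form_riesz_bounded_below y : C * `|y| <= `|form_riesz y|.
Proof.
apply: le_trans (form_op_bounded_below y) _.
by rewrite -[form_op bb y]riesz_invK opnorm_riesz_le.
Qed.

Lemma adjoint_form_solve (f : dual Y) : exists p, forall y, b y p = f y.
Proof.
have [y yf] := bounded_below_solve f C0 form_riesz_bounded_below.
by exists (form_riesz y) => z; rewrite -inner_form_riesz innerC yf.
Qed.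

Lemma form_inj y z : (forall v, b y v = b z v) -> y = z.
Proof.
move=> yz; apply/subr0_eq/normr0_eq0/eqP.
rewrite eq_le normr_ge0 andbT -(ler_pM2l C0) mulr0.
rewrite (le_trans (form_op_bounded_below _))//; apply: opnorm_le => v _.
by rewrite /= linearBl /= yz subrr normr0.
Qed.

Hypothesis nondeg : [set v : V | forall y : Y, b y v = 0] = [set 0].

Lemma form_nondegenerate v : (forall y, b y v = 0) -> v = 0.
Proof.
by move=> bv; have : [set v : V | forall y, b y v = 0] v by []; rewrite nondeg.
Qed.

Lemma adjoint_form_inj p q : (forall y, b y p = b y q) -> p = q.
Proof.
move=> pq; apply/subr0_eq/form_nondegenerate => y.
by rewrite linearBr /= pq subrr.
Qed.

(** With [A = form_riesz], the equation [<A y, A z> = f (A z)] is solvable. It says that [A y] and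
    [riesz_inv f] have the same pairing with the whole range of [A], and nondegeneracy makes them
    equal. *)
Lemma form_solve (f : dual V) : exists y, forall v, b y v = f v.
Proof.
have [y yf] := bounded_below_solve (comp_bop form_riesz f) C0
  form_riesz_bounded_below.
exists y => v; rewrite -inner_form_riesz -inner_riesz_inv; congr inner.
apply: adjoint_form_inj => z.
by rewrite -!inner_form_riesz innerC yf [RHS]innerC inner_riesz_inv.
Qed.

End inf_sup.
End hilbert.

(** * The control-to-state operator *)

Section control_to_state.
Context {R : realType} {U Y V : hilbertType R}.
Variables (b : {bilinear Y -> V -> R^o}) (D : bop U (dual V)).
Hypotheses (bb : bounded_bilinear b) (C : R) (C0 : 0 < C).
Hypothesis infsup : forall y : Y,
  C * `|y| <= sup [set b y v / `|v| | v in [set v : V | v != 0]].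
Hypothesis nondeg : [set v : V | forall y : Y, b y v = 0] = [set 0].

(** The chosen solutions depend linearly on [u] because they are unique; the inf-sup condition
    bounds [C * |S u|] by the norm of [D u]. *)
Lemma control_to_state : exists S : bop U Y, forall u v, b (S u) v = D u v.
Proof.
have /choice[S SE] u := form_solve bb C0 infsup nondeg (D u).
have lS : linear S.
  move=> a u w; apply: (form_inj bb C0 infsup) => v.
  by rewrite SE linearPl/= !SE linearP.
have bS : exists M : R, forall u, `|S u| <= M * `|u|.
  exists (C^-1 * opnorm D) => u; rewrite -mulrA ler_pdivlMl//.
  rewrite (le_trans (form_op_bounded_below bb infsup _))//.
  have -> : form_op bb (S u) = D u by apply: bopP => v; exact: SE.
  exact: (le_opnorm D u).
by exists (mk_bop lS bS).
Qed.

End control_to_state.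

(** * Convexity and expansion of the cost *)

Section reduced_cost.
Context {R : realType} {U Y W : hilbertType R}.
Variables (S : bop U Y) (O : bop Y W) (yd : W) (alpha : R).

(** Since [O] may have a kernel, strong convexity of the reduced cost is drawn from the [alpha]
    term, with modulus [alpha / 8]. *)
Lemma cost_midpoint (y z : Y) (u w : U) :
  cost O yd alpha (2^-1 *: (y + z)) (2^-1 *: (u + w)) +
    8^-1 * `|O (y - z)| ^+ 2 + alpha / 8 * `|u - w| ^+ 2 =
  (cost O yd alpha y u + cost O yd alpha z w) / 2.
Proof.
have normU := congr1 (fun r => alpha * r) (norm_midpoint u w).
have := norm_midpoint (O y - yd) (O z - yd).
have -> : 2^-1 *: (O y - yd + (O z - yd)) = O (2^-1 *: (y + z)) - yd.
  rewrite bopZ bopD addrACA -opprD scalerBr -mulr2n -(scaler_nat 2 yd).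
  by rewrite scalerK.
rewrite opprB addrA subrK -bopB /cost.
by lra.
Qed.

(** The exact second-order Taylor expansion; taking 0 as desired state turns [cost] into its
    homogeneous quadratic part. *)
Lemma cost_dirD (y z : Y) (u w : U) (t : R) :
  cost O yd alpha (y + t *: z) (u + t *: w) = cost O yd alpha y u +
  t * (inner (O y - yd) (O z) + alpha * inner u w) + t ^+ 2 * cost O 0 alpha z w.
Proof.
rewrite /cost subr0 bopD bopZ addrAC (normD_sqr (O y - yd)) (normD_sqr u).
rewrite !innerZr !normrZ !exprMn real_normK ?num_real//.
by field.
Qed.

Lemma cost_continuous : continuous (fun u => cost O yd alpha (S u) u).
Proof.
move=> u; apply: cvgD; apply: cvgMr; last exact: sqr_norm_continuous.
apply: (@continuous_comp _ _ _ (fun u => O (S u) - yd) (fun z => `|z| ^+ 2)).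
  apply: cvgB; last exact: cvg_cst.
  by apply: (@continuous_comp _ _ _ S O); exact: bop_continuous.
exact: sqr_norm_continuous.
Qed.

End reduced_cost.

(** * The optimality system *)

Theorem theorem3p2 (R : realType) (U Y V W : hilbertType R)
  (Uad : set U) (b : {bilinear Y -> V -> R^o}) (D : bop U (dual V))
  (O : bop Y W) (yd : W) (alpha : R)
  (Uad_neq0 : Uad !=set0) (Uad_bounded : bounded_set Uad)
  (Uad_closed : closed Uad)
  (Uad_convex : convex_set (Uad : set (convex_lmodType U)))
  (alpha_gt0 : 0 < alpha)
  (b_bounded : bounded_bilinear b)
  (b_infsup : exists2 C : R, 0 < C & forall y : Y,
     C * `|y| <= sup [set b y v / `|v| | v in [set v : V | v != 0]])
  (b_nondegenerate : [set v : V | forall y : Y, b y v = 0] = [set 0]) :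
  (exists! yu : Y * U, optimal Uad b D O yd alpha yu) /\
  forall (ybar : Y) (ubar : U), optimal Uad b D O yd alpha (ybar, ubar) ->
    (exists! p : V,
       adj_dual (form_op b_bounded) p = adj O (riesz (O ybar - yd))) /\
    forall pbar : V,
      adj_dual (form_op b_bounded) pbar = adj O (riesz (O ybar - yd)) ->
      forall u : U, Uad u ->
        0 <= inner (riesz_inv (adj_dual D pbar) + alpha *: ubar) (u - ubar).
Proof.
have [C C0 infsup] := b_infsup.
have [S SE] := control_to_state D b_bounded C0 infsup b_nondegenerate.
have stateE y u : (forall v, b y v = D u v) -> y = S u.
  by move=> yu; apply: (form_inj b_bounded C0 infsup) => v; rewrite yu SE.
have convUad u w (t : R) : 0 <= t -> t <= 1 -> Uad u -> Uad w ->
    Uad (t *: u + (1 - t) *: w).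
  by move=> t0 t1 Uu Uw; have := Uad_convex u w (Itv01 t0 t1); rewrite !inE; apply.
have alpha8 : 0 < alpha / 8 by rewrite divr_gt0.
have admS u : Uad u -> admissible Uad b D (S u, u) by split=> //= v; exact: SE.
have costM u w : cost O yd alpha (S (2^-1 *: (u + w))) (2^-1 *: (u + w)) +
    alpha / 8 * `|u - w| ^+ 2 <=
    (cost O yd alpha (S u) u + cost O yd alpha (S w) w) / 2.
  rewrite -cost_midpoint bopZ bopD lerD2r lerDl.
  by rewrite mulr_ge0// ?invr_ge0 ?sqr_ge0.
have UadM u w : Uad u -> Uad w -> Uad (2^-1 *: (u + w)).
  move=> Uu Uw; have := convUad u w 2^-1.
  rewrite (_ : 1 - 2^-1 = 2^-1) -?scalerDr; last by field.
  by apply=> //; lra.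
split.
  have [|u w Uu Uw|u Uu minu] :=
    strongly_convex_min alpha8 Uad_closed Uad_neq0
      (@cost_continuous _ _ _ _ S O yd alpha) (m := 0).
  - by move=> u _; rewrite addr_ge0// mulr_ge0// ?invr_ge0// divr_ge0// ltW.
  - by split; [exact: UadM|exact: costM].
  exists (S u, u); split.
    split; first exact: admS.
    by move=> [y w] [/= Uw /stateE ->]; exact: minu.
  move=> [y w] [[/= Uw /stateE ->]] /(_ _ (admS u Uu))/= minw.
  (* Both controls attain the minimum and their midpoint cannot go below it, so [costM] leaves no
     room for a positive [|u - w|]. *)
  have -> // : u = w.
  apply/subr0_eq/normr0_eq0/eqP; rewrite -sqrf_eq0 eq_le sqr_ge0 andbT.
  rewrite -(ler_pM2l alpha8) mulr0.
  by have := costM u w; have := minu _ (UadM _ _ Uu Uw); lra.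
move=> ybar ubar [[/= Uubar /stateE ->]] minu.
have adjE p : adj_dual (form_op b_bounded) p = adj O (riesz (O (S ubar) - yd)) <->
    forall y, b y p = inner (O (S ubar) - yd) (O y).
  split=> [E y|E]; last by apply: bopP => y; exact: E.
  exact: (congr1 (fun f : dual Y => f y) E).
split.
  have [p pE] := adjoint_form_solve b_bounded C0 infsup
    (adj O (riesz (O (S ubar) - yd))).
  exists p; split; first exact/adjE.
  move=> q /adjE qE; apply: (adjoint_form_inj b_nondegenerate) => y.
  by rewrite pE qE.
move=> p /adjE pE u Uu.
have -> : inner (riesz_inv (adj_dual D p) + alpha *: ubar) (u - ubar) =
    inner (O (S ubar) - yd) (O (S (u - ubar))) + alpha * inner ubar (u - ubar).
  by rewrite innerDl innerZl inner_riesz_inv -pE SE.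
(* The segment from [ubar] to [u] stays in [Uad], and along it [cost_dirD] gives the excess over the
   minimal cost as a quadratic in [t] whose linear coefficient is the goal. *)
apply: (@quadratic_slope_ge0 _ _ (cost O 0 alpha (S (u - ubar)) (u - ubar))).
move=> t t0 t1; rewrite -(lerD2l (cost O yd alpha (S ubar) ubar)) addr0 addrA.
rewrite -cost_dirD -bopZ -bopD.
have -> : ubar + t *: (u - ubar) = t *: u + (1 - t) *: ubar.
  by rewrite scalerBr scalerBl scale1r addrCA.
exact: (minu (_, _) (admS _ (convUad _ _ _ (ltW t0) t1 Uu Uubar))).
Qed.
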